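(* Let $G = J_n(m,m-1)$ be a Johnson graph with $n\geq m+1$ and let $H$ be a maximal clique in $G$. If $B$ denotes the union $B := \bigcup_{v\in V(H)}\nu(v)$, then $\bigcap_{v\in V(H)}\nu(v) = \emptyset$ if, and only if, $\nu(v_1)\cup\nu(v_2) = B$ for any distinct $v_1,v_2\in V(H)$.
   Context: $[n]=\{1,2,\ldots,n\}$ is the set of the first $n$ positive integers and $\binom{[n]}{m}$ is the collection of all subsets of $[n]$ of size $m$. The Johnson graph $J_n(m,m-1)$ is the undirected graph with $\binom{n}{m}$ nodes, each node $v$ labelled by a unique set $\nu(v)\in\binom{[n]}{m}$ (so $\nu$ is a bijection from the nodes to $\binom{[n]}{m}$), in which distinct nodes $v_i,v_j$ are joined by an edge if, and only if, $|\nu(v_i)\cap\nu(v_j)| = m-1$. A clique is a complete subgraph $H$, with vertex set $V(H)$; a clique is maximal if no larger clique contains it.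
   Formalization: The case m = 1, n ≥ 3 is excluded, since the claim fails there: J_n(1,0) is complete, its only maximal clique is the set of all nodes, with empty intersection and B = [n], but the union of two labels has only 2 elements. *)

(* Defs.v *)
From mathcomp Require Import all_boot.

Set Implicit Arguments.
Unset Strict Implicit.
Unset Printing Implicit Defensive.

(* The ground set [n] is 'I_n. The edge condition |nu u :&: nu v| = m - 1 is
   written with a successor, so that it is the equation over the integers even
   for m = 0. *)
Definition johnson_graph (n m : nat) (V : finType) (e : rel V)
    (nu : V -> {set 'I_n}) : Prop :=
  [/\ injective nu,
      nu @: [set: V] = [set A : {set 'I_n} | #|A| == m]
    & forall u v : V, e u v = (u != v) && (#|nu u :&: nu v|.+1 == m)].

(* A complete subgraph is given by its vertex set. *)
Definition clique (V : finType) (e : rel V) (H : {set V}) : bool :=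
  [forall u in H, forall v in H, (u != v) ==> e u v].

Definition maximal_clique (V : finType) (e : rel V) (H : {set V}) : bool :=
  maxset (clique e) H.

(* Main.v *)
Require Import Defs.
From mathcomp Require Import all_boot.
From mathcomp Require Import zify.

Set Implicit Arguments.
Unset Strict Implicit.
Unset Printing Implicit Defensive.

(** Two adjacent nodes carry m-sets A and A' whose union U has m + 1 elements,
    so the proposition says when a maximal clique consists of m-subsets of one
    (m + 1)-set.

    If the sets in the clique have no common point and m >= 2, then some C in
    the clique misses a point of the core D = A :&: A'.  Counting C against A
    and A' shows that any such C lies in U ([sub_setU_of_not_core]).  A set of
    the clique that contains D is D plus one point z; since it has m - 1 points
    in common with C, and C has at most m - 2 points in D, z belongs to C, hence
    to U.  So U contains the whole clique and equals B.  For m = 1 the core is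
    empty and this breaks down, but then n <= 2 and U is the whole ground set.

    Conversely, if any two sets of the clique have union B, then the clique lies
    in some (m + 1)-set C ([sub_succ_set]).  Any two m-subsets of C are adjacent
    ([card_setI_in_succ]), so by maximality every m-subset of C is in the clique.
    For x common to the clique, C minus x is such a subset, a contradiction. *)

(** * Counting in m-sets *)

(** Inclusion-exclusion: D not inside C costs C at least one point of A :&: A',
    so C meets A :|: A' in at least 2 (m - 1) - (m - 2) = m points. *)
Lemma sub_setU_of_not_core (T : finType) (m : nat) (A A' C : {set T}) :
  #|C| = m -> #|A :&: A'|.+1 = m -> #|C :&: A|.+1 = m -> #|C :&: A'|.+1 = m ->
  ~~ (A :&: A' \subset C) -> C \subset A :|: A'.
Proof.
move=> cC cAA' cCA cCA' nDC.
have ltD : #|C :&: (A :&: A')| < #|A :&: A'|.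
  apply: proper_card; rewrite properE subsetIr /=.
  by apply: contra nDC => /subset_trans; apply; apply: subsetIl.
have := cardsUI (C :&: A) (C :&: A'); rewrite -setIUr -setIIr => cU.
suff /eqP <- : C :&: (A :|: A') == C by apply: subsetIr.
by rewrite eqEcard subsetIl /=; lia.
Qed.

Lemma card_setI_in_succ (T : finType) (m : nat) (C A A' : {set T}) :
  #|C| = m.+1 -> A \subset C -> A' \subset C -> #|A| = m -> #|A'| = m ->
  A != A' -> #|A :&: A'|.+1 = m.
Proof.
move=> cC sAC sA'C cA cA' neq.
have := cardsUI A A'.
have sUC : A :|: A' \subset C by rewrite subUset sAC.
have := subset_leq_card sUC.
have ltI : #|A :&: A'| < #|A|.
  apply: proper_card; rewrite properE subsetIl /=.
  apply: contra neq => sAI; rewrite eqEcard cA cA' leqnn andbT.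
  exact: subset_trans sAI (subsetIr _ _).
lia.
Qed.

(** * Cliques of Johnson graphs *)

Lemma johnson_card (n m : nat) (V : finType) (e : rel V)
    (nu : V -> {set 'I_n}) (v : V) : johnson_graph m e nu -> #|nu v| = m.
Proof.
case=> _ im _; have : nu v \in nu @: [set: V] by apply: imset_f; rewrite inE.
by rewrite im inE => /eqP.
Qed.

Lemma johnson_node (n m : nat) (V : finType) (e : rel V)
    (nu : V -> {set 'I_n}) (A : {set 'I_n}) :
  johnson_graph m e nu -> #|A| = m -> exists w, nu w = A.
Proof.
case=> _ im _ cA; have : A \in nu @: [set: V] by rewrite im inE cA.
by case/imsetP=> w _ ->; exists w.
Qed.

Lemma johnson_clique_cardI (n m : nat) (V : finType) (e : rel V)
    (nu : V -> {set 'I_n}) (H : {set V}) (u v : V) :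
  johnson_graph m e nu -> clique e H -> u \in H -> v \in H -> u != v ->
  #|nu u :&: nu v|.+1 = m.
Proof.
case=> _ _ eE /'forall_implyP/(_ u) cl uH vH uv.
have /'forall_implyP/(_ v vH)/implyP/(_ uv) := cl uH.
by rewrite eE => /andP[_ /eqP].
Qed.

Lemma johnson_clique_cardU (n m : nat) (V : finType) (e : rel V)
    (nu : V -> {set 'I_n}) (H : {set V}) (u v : V) :
  johnson_graph m e nu -> clique e H -> u \in H -> v \in H -> u != v ->
  #|nu u :|: nu v| = m.+1.
Proof.
move=> hG cH uH vH uv; have := johnson_clique_cardI hG cH uH vH uv.
have := cardsUI (nu u) (nu v); rewrite !(johnson_card _ hG); lia.
Qed.

Lemma maximal_clique_absorb (V : finType) (e : rel V) (H : {set V}) (w : V) :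
  maximal_clique e H ->
  (forall v, v \in H -> v != w -> e v w /\ e w v) -> w \in H.
Proof.
case/maxsetP=> cH maxH adj.
suff cwH : clique e (w |: H) by rewrite -(maxH _ cwH (subsetUr _ _)) setU11.
apply/'forall_implyP=> u /setU1P uwH.
apply/'forall_implyP=> v /setU1P vwH; apply/implyP=> uv.
case: uwH vwH uv => [->|uH] [->|vH] uv.
- by rewrite eqxx in uv.
- by rewrite eq_sym in uv; have [] := adj v vH uv.
- by have [] := adj u uH uv.
- by move/'forall_implyP/(_ u uH)/'forall_implyP/(_ v vH)/implyP: cH; apply.
Qed.

Lemma maximal_clique_neq0 (V : finType) (e : rel V) (H : {set V}) (w : V) :
  maximal_clique e H -> exists v, v \in H.
Proof.
move=> mH; apply/set0Pn; apply/eqP=> H0.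
suff : w \in H by rewrite H0 inE.
by apply: (maximal_clique_absorb mH) => v; rewrite H0 inE.
Qed.

(** The m-subsets of an (m + 1)-set are pairwise adjacent, so a maximal clique
    inside one contains them all. *)
Lemma maximal_clique_in_succ (n m : nat) (V : finType) (e : rel V)
    (nu : V -> {set 'I_n}) (H : {set V}) (C : {set 'I_n}) (w : V) :
  johnson_graph m e nu -> maximal_clique e H -> #|C| = m.+1 ->
  (forall v, v \in H -> nu v \subset C) -> nu w \subset C -> w \in H.
Proof.
move=> hG mH cC sHC swC; apply: (maximal_clique_absorb mH) => v vH vw.
have [inj _ eE] := hG.
have nuvw : nu v != nu w by apply: contra vw => /eqP/inj->.
have cI := card_setI_in_succ cC (sHC v vH) swC (johnson_card v hG)
             (johnson_card w hG) nuvw.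
by rewrite !eE [w == v]eq_sym vw (setIC (nu w)) cI eqxx.
Qed.

(** Two distinct nodes of H determine the (m + 1)-set; a single node leaves the
    choice of an extra point, which n > m provides. *)
Lemma sub_succ_set (n m : nat) (V : finType) (e : rel V)
    (nu : V -> {set 'I_n}) (H : {set V}) (v0 : V) :
  m < n -> johnson_graph m e nu -> clique e H -> v0 \in H ->
  (forall v1 v2, v1 \in H -> v2 \in H -> v1 != v2 ->
     nu v1 :|: nu v2 = \bigcup_(v in H) nu v) ->
  exists2 C : {set 'I_n}, #|C| = m.+1 & forall v, v \in H -> nu v \subset C.
Proof.
move=> ltmn hG cH v0H hU.
case: (pickP [pred v in H | v != v0]) => [v1 /andP[v1H v10]|only].
  exists (nu v1 :|: nu v0); first exact: johnson_clique_cardU hG cH v1H v0H v10.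
  by move=> v vH; rewrite hU //; apply: (bigcup_sup v).
have [y yv0] : exists y, y \in ~: nu v0.
  apply/set0Pn; rewrite -card_gt0.
  by have := cardsC (nu v0); rewrite (johnson_card _ hG) card_ord; lia.
exists (y |: nu v0) => [|v vH].
  by rewrite cardsU1 (johnson_card _ hG) -in_setC yv0.
have := only v; rewrite inE vH /= => /negbFE/eqP->.
exact: subsetUr.
Qed.

(** * The two implications *)

Lemma bigcap0_of_setU_eq (n m : nat) (V : finType) (e : rel V)
    (nu : V -> {set 'I_n}) (H : {set V}) :
  m < n -> johnson_graph m e nu -> maximal_clique e H -> H != set0 ->
  (forall v1 v2, v1 \in H -> v2 \in H -> v1 != v2 ->
     nu v1 :|: nu v2 = \bigcup_(v in H) nu v) ->
  \bigcap_(v in H) nu v = set0.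
Proof.
move=> ltmn hG mH /set0Pn[v0 v0H] hU; have cH := maxsetp mH.
have [C cC sHC] := sub_succ_set ltmn hG cH v0H hU.
apply/setP=> x; rewrite inE; apply/negP=> /bigcapP xall.
have xC : x \in C by apply: (subsetP (sHC v0 v0H)); apply: xall.
have cCx : #|C :\ x| = m by have := cardsD1 x C; rewrite xC cC; lia.
have [w nuw] := johnson_node hG cCx.
have wH : w \in H.
  by apply: (maximal_clique_in_succ hG mH cC sHC); rewrite nuw subD1set.
by have := xall w wH; rewrite nuw !inE eqxx.
Qed.

(** One node w missing a point of the core suffices: it traps the nodes that
    contain the core, and [sub_setU_of_not_core] deals with the others. *)
Lemma clique_sub_setU (n m : nat) (V : finType) (e : rel V)
    (nu : V -> {set 'I_n}) (H : {set V}) (v1 v2 w z : V) :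
  johnson_graph m e nu -> clique e H ->
  v1 \in H -> v2 \in H -> w \in H -> z \in H -> v1 != v2 ->
  ~~ (nu v1 :&: nu v2 \subset nu w) -> nu z \subset nu v1 :|: nu v2.
Proof.
move=> hG cH v1H v2H wH zH v12.
have cI u v (uH : u \in H) (vH : v \in H) := johnson_clique_cardI hG cH uH vH.
have missing u : u \in H -> ~~ (nu v1 :&: nu v2 \subset nu u) ->
    nu u \subset nu v1 :|: nu v2.
  move=> uH nDu; apply: (@sub_setU_of_not_core _ m) => //.
  - exact: johnson_card hG.
  - exact: cI.
  - apply: cI => //; apply: contra nDu => /eqP->; exact: subsetIl.
  - apply: cI => //; apply: contra nDu => /eqP->; exact: subsetIr.
move=> nDw; have [sDz|] := boolP (nu v1 :&: nu v2 \subset nu z); last exact: missing.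
have zw : z != w by apply: contra nDw => /eqP<-.
(* A point of nu z outside both D and nu w would make nu z equal to D plus that
   point, and nu w could not meet nu z in m - 1 points. *)
have cIzw := cI z w zH wH zw.
have cD := cI v1 v2 v1H v2H v12.
have cz := johnson_card z hG.
set D := nu v1 :&: nu v2 in nDw sDz cD *.
have ltDw : #|D :&: nu w| < #|D|.
  apply: proper_card; rewrite properE subsetIl /=.
  by apply: contra nDw => /subset_trans; apply; apply: subsetIr.
apply/subsetP=> x xz; have [|xDw] := boolP (x \in D :|: nu w).
  case/setUP=> [/setIP[xv1 _]|xw]; first by rewrite inE xv1.
  exact: (subsetP (missing w wH nDw)).
suff : nu z :&: nu w \subset D :&: nu w.
  by move/subset_leq_card; lia.
have zE : x |: D = nu z.
  apply/eqP; rewrite eqEcard subUset sub1set xz sDz cz cardsU1.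
  by move: xDw; rewrite inE negb_or => /andP[-> _] /=; rewrite add1n cD.
rewrite -zE; apply/subsetP=> y /setIP[/setU1P[->|yD] yw].
  by move: xDw; rewrite inE yw orbT.
by rewrite inE yD.
Qed.

Lemma setU_eq_of_bigcap0 (n m : nat) (V : finType) (e : rel V)
    (nu : V -> {set 'I_n}) (H : {set V}) (v1 v2 : V) :
  (m = 1 -> n <= 2) -> johnson_graph m e nu -> clique e H ->
  \bigcap_(v in H) nu v = set0 -> v1 \in H -> v2 \in H -> v1 != v2 ->
  nu v1 :|: nu v2 = \bigcup_(v in H) nu v.
Proof.
move=> hm1 hG cH cap0 v1H v2H v12.
apply/eqP; rewrite eqEsubset subUset; apply/andP; split.
  by apply/andP; split; [apply: (bigcup_sup v1) | apply: (bigcup_sup v2)].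
have cD := johnson_clique_cardI hG cH v1H v2H v12.
apply/bigcupsP=> z zH; have [m1|m1] := eqVneq m 1.
  suff /eqP -> : nu v1 :|: nu v2 == setT by apply: subsetT.
  rewrite eqEcard subsetT cardsT card_ord.
  by rewrite (johnson_clique_cardU hG cH v1H v2H v12) m1 hm1.
have [d dD] : exists d, d \in nu v1 :&: nu v2.
  by apply/set0Pn; rewrite -card_gt0; lia.
have : d \notin \bigcap_(v in H) nu v by rewrite cap0 inE.
case: (pickP [pred w in H | d \notin nu w]) => [w /andP[wH dw] _|all].
  apply: (clique_sub_setU hG cH v1H v2H wH zH v12).
  by apply: contra dw => /subsetP; apply.
case/negP; apply/bigcapP=> w wH.
by have := all w; rewrite inE wH /= => /negbFE.
Qed.

(* Hypothesis hm1 excludes exactly the graphs J_n(1,0) = K_n with n >= 3: there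
   the maximal clique of all singletons has empty intersection, but the union of
   two singletons is not [n]. *)
Theorem proposition3p1 (n m : nat) (V : finType) (e : rel V)
    (nu : V -> {set 'I_n}) (H : {set V})
    (hnm : m + 1 <= n) (hm1 : m = 1 -> n <= 2)
    (hG : johnson_graph m e nu) (hH : maximal_clique e H) :
  let B := \bigcup_(v in H) nu v in
  \bigcap_(v in H) nu v = set0 <->
  (forall v1 v2 : V, v1 \in H -> v2 \in H -> v1 != v2 -> nu v1 :|: nu v2 = B).
Proof.
move=> B; have ltmn : m < n by rewrite -addn1.
split=> [cap0 v1 v2|].
  exact: setU_eq_of_bigcap0 hm1 hG (maxsetp hH) cap0.
apply: (bigcap0_of_setU_eq ltmn hG hH).
(* The graph has a node, labelled by the first m points of the ground set. *)
have [A cA] : exists A : {set 'I_n}, #|A| = m.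
  exists [set widen_ord (ltnW ltmn) i | i : 'I_m].
  rewrite card_imset ?card_ord // => i j /(congr1 val) /= ij; exact: val_inj.
have [w _] := johnson_node hG cA.
by apply/set0Pn; apply: maximal_clique_neq0 w hH.
Qed.
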